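(* Let $d\ge 1$ and $n\ge 3$ be integers, let $\mathbf{F}=\{\mathcal{B}(x_1,1),\dots,\mathcal{B}(x_n,1)\}$ be a family of $n$ pinned balls in $\mathbb{R}^d$ (closed unit balls with pairwise disjoint interiors), let $(\mathcal{V}_1,\mathcal{E}_1)$ be a graph associated with $\mathbf{F}$, let $\Gamma=(\gamma_j,\ j\ge 1)$ be a sequence with $\gamma_j\in\mathcal{E}_1$ for all $j$, and let $v(0)\in\mathbb{R}^{nd}$ be an arbitrary vector of initial pseudo-velocities. Define $v(j)=\mathcal{T}_{\gamma_j}(v(j-1))$ for $j\ge 1$. Then the number of collisions, i.e. the number of indices $j\ge 1$ such that $v(j)\neq v(j-1)$, is at most $$2^{-27}\, 2^{16\ell}\, n^{-27/2}\, n^{15\ell/2},\qquad\text{where } \ell=\tfrac12\, n\,\min(\tau_d,\ n)$$ and $\tau_d$ is the kissing number of a $d$-dimensional ball.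
   Context: Notation: $\mathcal{B}(x,r)$ is the closed ball with center $x$ and radius $r$ in a Euclidean space. The balls $\mathcal{B}(x_1,1),\dots,\mathcal{B}(x_n,1)\subset\mathbb{R}^d$ have pairwise disjoint interiors, but they may touch: balls $i$ and $j$ touch if $|x_i-x_j|=2$. The centers $x_k$ are fixed (the balls do not move). Graphs: the full graph $(\mathcal{V},\mathcal{E})$ associated with $\mathbf{F}$ has vertex set $\mathcal{V}=\{x_1,\dots,x_n\}$, and $x_j$, $x_k$ are connected by an (undirected) edge, denoted $(j,k)$, if and only if $|x_j-x_k|=2$. A graph associated with $\mathbf{F}$ is any subgraph $(\mathcal{V}_1,\mathcal{E}_1)$ of the full graph, i.e. $\mathcal{V}_1\subset\mathcal{V}$ and $\mathcal{E}_1\subset\mathcal{E}$. Pseudo-velocities and collision maps: a vector $v=(v_1,\dots,v_n)\in\mathbb{R}^{nd}$ with $v_k\in\mathbb{R}^d$ lists the pseudo-velocities of the balls. For $1\le i,j\le n$ the map $\mathcal{T}_{ij}:\mathbb{R}^{nd}\to\mathbb{R}^{nd}$, $\mathcal{T}_{ij}(v)=w=(w_1,\dots,w_n)$, is defined as follows. For all $k\ne i,j$, $w_k=v_k$. If balls $i$ and $j$ do not touch, then $w=v$. If they touch and $(v_i-v_j)\cdot(x_i-x_j)\ge 0$, then $w=v$. If they touch and $(v_i-v_j)\cdot(x_i-x_j)<0$, then with $u=(x_i-x_j)/|x_i-x_j|$, $$w_i=v_i+(v_j\cdot u)u-(v_i\cdot u)u,\qquad w_j=v_j+(v_i\cdot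 u)u-(v_j\cdot u)u.$$ One has $\mathcal{T}_{ij}=\mathcal{T}_{ji}$. If $\gamma$ is an edge connecting $x_i$ and $x_m$ then $\mathcal{T}_\gamma$ means $\mathcal{T}_{im}$. A ''collision'' occurs when applying $\mathcal{T}_\gamma$ changes the vector of pseudo-velocities. Kissing number: $\tau_d$ is the maximum number of mutually nonoverlapping translates (i.e. with disjoint interiors) of a $d$-dimensional ball that can be arranged so that they all touch the given ball and do not overlap it. *)

(* Defs.v *)
From HB Require Import structures.
From mathcomp Require Import all_boot all_order all_algebra.
From mathcomp Require Import finmap.
From mathcomp Require Import all_classical all_reals all_analysis.
From mathcomp Require Import ring lra.

Set Implicit Arguments.
Unset Strict Implicit.
Unset Printing Implicit Defensive.

Import Order.TTheory GRing.Theory Num.Theory.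
Import numFieldNormedType.Exports.

Local Open Scope classical_set_scope.
Local Open Scope ring_scope.

(* The library norm on 'rV[R]_d is the sup norm, hence the explicit Euclidean
   structure.  The topology of 'rV[R]_d is the product topology, i.e. the
   Euclidean one, so that [interior] below is the usual interior. *)
Definition dotp (R : realType) (d : nat) (u w : 'rV[R]_d) : R :=
  \sum_(k < d) u 0 k * w 0 k.

Definition enorm (R : realType) (d : nat) (u : 'rV[R]_d) : R :=
  Num.sqrt (dotp u u).

Definition unit_ball (R : realType) (d : nat) (c : 'rV[R]_d) : set 'rV[R]_d :=
  closed_ball_ (@enorm R d) c 1.

Definition nonoverlapping (R : realType) (d : nat) (p q : 'rV[R]_d) : Prop :=
  interior (unit_ball p) `&` interior (unit_ball q) = set0.

Definition touching (R : realType) (d : nat) (p q : 'rV[R]_d) : bool :=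
  enorm (p - q) == 2.

Definition pinned_balls (R : realType) (n d : nat) (x : 'I_n -> 'rV[R]_d) :
    Prop :=
  forall i j : 'I_n, i != j -> nonoverlapping (x i) (x j).

(* m unit balls can be arranged around the unit ball centred at the origin. *)
Definition kissing (R : realType) (d m : nat) : Prop :=
  exists y : 'I_m -> 'rV[R]_d,
    pinned_balls y /\
    (forall i : 'I_m, touching (y i) 0 /\ nonoverlapping (y i) 0).

(* The default value 0 is never used, see [kissing_numberP]. *)
Definition kissing_number (R : realType) (d : nat) : nat :=
  xget 0%N [set m : nat | kissing R d m /\
                          forall k : nat, kissing R d k -> (k <= m)%N].

(* Vertices are named by the indices of the centres.  An undirected edge (i, j)
   is encoded by a symmetric relation. *)
Definition associated_graph (R : realType) (n d : nat) (x : 'I_n -> 'rV[R]_d)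
    (V1 : {set 'I_n}) (E1 : rel 'I_n) : Prop :=
  symmetric E1 /\
  (forall i j : 'I_n, E1 i j -> [/\ i \in V1, j \in V1 & touching (x i) (x j)]).

Definition collide (R : realType) (n d : nat) (x : 'I_n -> 'rV[R]_d)
    (i j : 'I_n) (v : {ffun 'I_n -> 'rV[R]_d}) : {ffun 'I_n -> 'rV[R]_d} :=
  if touching (x i) (x j) && (dotp (v i - v j) (x i - x j) < 0) then
    let u := (enorm (x i - x j))^-1 *: (x i - x j) in
    [ffun k => if k == i then v i + dotp (v j) u *: u - dotp (v i) u *: u
               else if k == j then v j + dotp (v i) u *: u - dotp (v j) u *: u
               else v k]
  else v.

(* The pair (gamma j).1, (gamma j).2 lists the endpoints of the j-th edge, in an
   order that does not matter by [collideC].  Indexing starts at 1: gamma 0 is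
   not used. *)
Fixpoint evolve (R : realType) (n d : nat) (x : 'I_n -> 'rV[R]_d)
    (gamma : nat -> 'I_n * 'I_n) (v0 : {ffun 'I_n -> 'rV[R]_d}) (j : nat) :
    {ffun 'I_n -> 'rV[R]_d} :=
  if j is k.+1 then
    collide x (gamma k.+1).1 (gamma k.+1).2 (evolve x gamma v0 k)
  else v0.

Definition collision_times (R : realType) (n d : nat) (x : 'I_n -> 'rV[R]_d)
    (gamma : nat -> 'I_n * 'I_n) (v0 : {ffun 'I_n -> 'rV[R]_d}) : set nat :=
  [set j : nat | (1 <= j)%N /\
                 evolve x gamma v0 j != evolve x gamma v0 j.-1].

Lemma dotpN (R : realType) (d : nat) (u w : 'rV[R]_d) :
  dotp (- u) (- w) = dotp u w.
Proof. by apply: eq_bigr => k _; rewrite !mxE mulrNN. Qed.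

Lemma dotprN (R : realType) (d : nat) (u w : 'rV[R]_d) :
  dotp u (- w) = - dotp u w.
Proof. by rewrite /dotp -sumrN; apply: eq_bigr => k _; rewrite !mxE mulrN. Qed.

Lemma enormN (R : realType) (d : nat) (u : 'rV[R]_d) : enorm (- u) = enorm u.
Proof. by rewrite /enorm dotpN. Qed.

Lemma touchingC (R : realType) (d : nat) (p q : 'rV[R]_d) :
  touching p q = touching q p.
Proof. by rewrite /touching -enormN opprB. Qed.

Lemma collideC (R : realType) (n d : nat) (x : 'I_n -> 'rV[R]_d) (i j : 'I_n)
    (v : {ffun 'I_n -> 'rV[R]_d}) :
  collide x i j v = collide x j i v.
Proof.
rewrite /collide touchingC -(opprB (v j)) -(opprB (x j)) dotpN enormN.
case: ifP => // _; apply/ffunP => k; rewrite !ffunE scalerN.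
set u := _ *: (x j - x i); rewrite !dotprN !scaleNr !scalerN !opprK.
by case: (eqVneq k i) => [<-|_]; case: (eqVneq k j) => [<-|_].
Qed.

Lemma enorm_le_sum (R : realType) (d : nat) (u : 'rV[R]_d) :
  enorm u <= \sum_(k < d) `|u 0 k|.
Proof.
have s0 : 0 <= \sum_(k < d) `|u 0 k| by apply: sumr_ge0.
rewrite /enorm -(ger0_norm s0) -sqrtr_sqr ler_wsqrtr // expr2 mulr_suml.
apply: ler_sum => k _; rewrite -expr2 -real_normK ?num_real // expr2.
by rewrite ler_wpM2l // (bigD1 k) //= lerDl sumr_ge0.
Qed.

Lemma coord_le_enorm (R : realType) (d : nat) (u : 'rV[R]_d) (k : 'I_d) :
  `|u 0 k| <= enorm u.
Proof.
rewrite -sqrtr_sqr ler_wsqrtr // /dotp (bigD1 k) //= expr2 lerDl.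
by apply: sumr_ge0 => l _; rewrite -expr2 sqr_ge0.
Qed.

Lemma overlap_close (R : realType) (d : nat) (p q : 'rV[R]_d) (e : R) :
  0 < e -> d%:R * (2 * e) <= 1 -> (forall k, `|q 0 k - p 0 k| < e) ->
  ~ nonoverlapping p q.
Proof.
move=> e0 de pq.
have in_int (c : 'rV[R]_d) : (forall k, `|c 0 k - p 0 k| < e) ->
    interior (unit_ball c) p.
  move=> cp; apply/nbhs_ballP; exists e => //= z [_ pz].
  rewrite /unit_ball /closed_ball_ /=; apply: le_trans (enorm_le_sum _) _.
  apply: le_trans de; rewrite -[d in d%:R]card_ord mulr_natl -sumr_const.
  apply: ler_sum => k _; rewrite !mxE.
  have := ltW (pz 0 k); rewrite /ball /= => pzk.
  rewrite (_ : c 0 k - z 0 k = (c 0 k - p 0 k) + (p 0 k - z 0 k)); last by ring.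
  by rewrite (le_trans (ler_normD _ _)) // mulr_natl mulr2n lerD // ltW.
move=> /seteqP[/(_ p) + _]; apply; split; apply: in_int => // k.
by rewrite subrr normr0.
Qed.

Lemma kissing_bounded (R : realType) (d m : nat) :
  kissing R d m -> (m <= (8 * d.+1).+1 ^ d)%N.
Proof.
case=> y [yy y0]; set K := (8 * d.+1)%N.
pose e : R := (2 * d.+1%:R)^-1.
have e0 : 0 < e by rewrite invr_gt0 mulr_gt0.
have eE : 2 * d.+1%:R * e = 1 by rewrite mulfV // mulf_neq0.
have bnd i k : 0 <= y i 0 k + 2 <= 4.
  have [/eqP yi2 _] := y0 i; have := coord_le_enorm (y i) k.
  by move: yi2; rewrite subr0 => ->; rewrite ler_norml => /andP[? ?]; lra.
pose cell i : {ffun 'I_d -> 'I_K.+1} :=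
  [ffun k => inord (Num.truncn ((y i 0 k + 2) / e))].
have ge i k : 0 <= (y i 0 k + 2) / e.
  by have /andP[? _] := bnd i k; rewrite divr_ge0 // ltW.
have cellE i k : cell i k = Num.truncn ((y i 0 k + 2) / e) :> nat.
  rewrite ffunE inordK // ltnS -(ler_nat R).
  apply: (@le_trans _ _ ((y i 0 k + 2) / e)); first by rewrite truncn_le.
  rewrite ler_pdivrMr // natrM -[8%:R * _ * _]mulrA.
  have -> : d.+1%:R * e = 2^-1 by move: eE; lra.
  by have /andP[_ ?] := bnd i k; lra.
have /leq_card : injective cell.
  move=> i j cij; apply: contrapT => /eqP ij.
  apply: (@overlap_close _ _ (y i) (y j) e e0) (yy i j ij).
    by rewrite -[leRHS]eE mulrA [2 * d.+1%:R]mulrC !ler_pM2r // ler_nat.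
  move=> k; have := cellE i k; rewrite cij cellE => tt.
  have /andP[li ui] := truncn_itv (ge i k).
  have /andP[lj uj] := truncn_itv (ge j k).
  move: li ui lj uj; rewrite tt; set t := Num.truncn _.
  rewrite ler_pdivlMr // ltr_pdivrMr // ler_pdivlMr // ltr_pdivrMr //.
  by rewrite -[t.+1%:R]natr1 mulrDl mul1r ltr_norml => *; apply/andP; split; lra.
by rewrite card_ffun !card_ord.
Qed.

Lemma kissing_numberP (R : realType) (d : nat) :
  kissing R d (kissing_number R d) /\
  forall k : nat, kissing R d k -> (k <= kissing_number R d)%N.
Proof.
have ex : exists m, `[< kissing R d m >].
  exists 0%N; apply/asboolP; exists (fun=> 0).
  by split=> [[]|[]].
have ub m : `[< kissing R d m >] -> (m <= (8 * d.+1).+1 ^ d)%N.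
  by move/asboolP/kissing_bounded.
rewrite /kissing_number; case: xgetP => [m _ //|/(_ (ex_maxn ex ub))]; case.
case: ex_maxnP => m /asboolP mk mx; split=> // k kk; apply: mx.
exact/asboolP.
Qed.

(* Main.v *)
Require Import Defs.
From mathcomp Require Import all_boot all_order all_algebra.
From mathcomp Require Import finmap.
From mathcomp Require Import all_classical all_reals all_analysis.
From mathcomp Require Import ring lra zify.

Set Implicit Arguments.
Unset Strict Implicit.

Import Order.TTheory GRing.Theory Num.Theory.
Import numFieldNormedType.Exports.

Local Open Scope classical_set_scope.
Local Open Scope ring_scope.

(** A collision along an edge is a folding of the velocity space: it reflects
    the velocity vector in a hyperplane whenever that vector lies on the wrong
    side.  For an edge between touching balls i and j the hyperplane has normal
    [impulse x i j], of squared norm 2.  All the half-spaces of the folding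
    contain a common interior point, namely (half) the vector of the centres:
    its scalar product with every normal is 1.

    Let z be such a point, and call the scalar product of v with z the height
    of v.  If the scalar product of v with a normal is - t < 0, the folding by
    this normal raises the height by t, so that the rise of the height controls how far v travels.
    Consider a stretch of the trajectory that uses every normal that occurs at
    all, and let L be its rise.  At its end v violates no constraint by more
    than 2 L, since each constraint held at some moment of the stretch; hence
    v + 2 L z lies in all the half-spaces.  Foldings do not increase the
    distance to such a point, so the whole future trajectory stays within
    2 L |z| of it, and the future rise is at most 4 L |z|^2 ([future_rise]).
    The sequence of foldings read backwards from the opposite of the final
    vector is again a sequence of foldings, so the past rise obeys the same
    bound ([past_rise]).  The rise of the stretch is therefore at least the
    total rise divided by 8 |z|^2 + 1 ([block_rise]), and there can be at most
    8 |z|^2 + 1 disjoint stretches of this kind, however degenerate the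
    arrangement of hyperplanes is.  Induction on the number N of normals, where
    every sufficiently long block has to use all of them, bounds the number of
    foldings by q ^ N for every integer q > 8 |z|^2 + 1 ([folding_bound]).

    Recentring each connected component of the graph at one of its balls
    changes no edge vector and gives |z|^2 <= n^3, because a path without
    repetitions has fewer than n edges of length 2.  So q = 8 n^3 + 2 will do.
    The neighbours of a ball form a kissing arrangement, which gives
    N <= l ([card_edges]).  Finally q <= 2^4 n^3, and (2^4 n^3)^l is below the
    announced bound as soon as l >= 3, which follows from n >= 3 and the fact
    that the kissing number is at least 2. *)

(** * Sequences of foldings *)

Section Foldings.

Variables (R : realFieldType) (V : lmodType R) (B : V -> V -> R).
Hypothesis formC : forall u v, B u v = B v u.
Hypothesis formDl : forall u v w, B (u + v) w = B u w + B v w.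
Hypothesis formZl : forall c u w, B (c *: u) w = c * B u w.
Hypothesis form_ge0 : forall u, 0 <= B u u.

Variables (A : {pred V}) (z : V).
Hypothesis normal_sq : {in A, forall a, B a a = 2}.
Hypothesis normal_z : {in A, forall a, B a z = 1}.

Let formNl u w : B (- u) w = - B u w.
Proof. by rewrite -scaleN1r formZl mulN1r. Qed.

Let formBl u v w : B (u - v) w = B u w - B v w.
Proof. by rewrite formDl formNl. Qed.

Let formDr u v w : B w (u + v) = B w u + B w v.
Proof. by rewrite formC formDl !(formC w). Qed.

Let formBr u v w : B w (u - v) = B w u - B w v.
Proof. by rewrite formC formBl !(formC w). Qed.

Let formZr c u w : B w (c *: u) = c * B w u.
Proof. by rewrite formC formZl formC. Qed.

Definition mirror (a v : V) : V := v - B v a *: a.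

Definition travel (v : V) (s : seq V) : V :=
  foldl (fun w a => mirror a w) v s.

(** A reflection is required to change the vector, so that the length of [s] counts
    collisions. *)
Fixpoint folding (v : V) (s : seq V) : bool :=
  if s is a :: s' then [&& a \in A, B v a < 0 & folding (mirror a v) s']
  else true.

Lemma travel_cat v s t : travel v (s ++ t) = travel (travel v s) t.
Proof. exact: foldl_cat. Qed.

Lemma folding_cat v s t :
  folding v (s ++ t) = folding v s && folding (travel v s) t.
Proof. by elim: s v => //= a s IH v; rewrite IH !andbA. Qed.

Lemma folding_normal v s : folding v s -> {subset s <= A}.
Proof.
elim: s v => //= a s IH v /and3P[aA _ /IH sA] b.
by rewrite inE => /predU1P[->|/sA].
Qed.

Lemma mirror_normal a v : a \in A -> B (mirror a v) a = - B v a.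
Proof. by move=> aA; rewrite formBl formZl normal_sq //; ring. Qed.

(** This is what makes a folding sequence reversible: up to the sign, the
    reflected vector violates the same constraint by the same amount. *)
Lemma mirrorN a v : a \in A -> mirror a (- mirror a v) = - v.
Proof.
move=> aA; rewrite {1}/mirror formNl mirror_normal // opprK /mirror opprB.
by rewrite addrAC subrr sub0r.
Qed.

Lemma folding_rev v s : folding v s ->
  folding (- travel v s) (rev s) /\ travel (- travel v s) (rev s) = - v.
Proof.
elim: s v => //= a s IH v /and3P[aA va /IH[fs ts]].
rewrite rev_cons -cats1 folding_cat travel_cat fs ts /= aA mirrorN //.
by rewrite formNl mirror_normal // opprK va.
Qed.

(** Since [B v a] is negative when [a] folds [v], the height increases by
    exactly the depth of the violation. *)
Lemma height_step a v : a \in A -> B (mirror a v) z = B v z - B v a.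
Proof. by move=> aA; rewrite formBl formZl (normal_z aA) mulr1. Qed.

Lemma height_le v s : folding v s -> B v z <= B (travel v s) z.
Proof.
elim: s v => //= a s IH v /and3P[aA va /IH]; rewrite height_step //.
by apply: le_trans; lra.
Qed.

Lemma height_lt v s : folding v s -> s != [::] -> B v z < B (travel v s) z.
Proof.
case: s => //= a s /and3P[aA va /height_le]; rewrite height_step // => h _.
by apply: lt_le_trans h; lra.
Qed.

(** A case of the Cauchy-Schwarz inequality for two vectors of squared norm 2,
    read off from the squared norm of their sum. *)
Lemma normal_slope a b : a \in A -> b \in A -> - 2 <= B a b.
Proof.
move=> aA bA; have := form_ge0 (a + b).
rewrite formDl !formDr (formC b a) !normal_sq //; lra.
Qed.

(** A folding by [a] adds a multiple of [a] equal to the rise of the height, and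
    [normal_slope] limits what this does to any other constraint. *)
Lemma drop_le v s b : folding v s -> b \in A ->
  B v b - 2 * (B (travel v s) z - B v z) <= B (travel v s) b.
Proof.
move=> + bA; elim: s v => /= [|a s IH] v; first by rewrite subrr mulr0 subr0.
move=> /and3P[aA va /IH]; rewrite height_step // {1}/mirror formBl formZl.
by have ab := normal_slope aA bA; nra.
Qed.

(** The constraint [b] is satisfied right after a folding by [b], and from there
    on [drop_le] applies. *)
Lemma visited_ge v s b : folding v s -> b \in s ->
  - (2 * (B (travel v s) z - B v z)) <= B (travel v s) b.
Proof.
move=> fs bs; have bA := folding_normal fs bs.
case/splitPr: bs fs => p q; rewrite folding_cat travel_cat /=.
move=> /and3P[fp _ /andP[vb fq]].
have := height_le fp; have := drop_le fq bA.
by rewrite height_step // mirror_normal //; lra.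
Qed.

(** Reflecting a point to the side of the hyperplane where [y] lies does not
    move it away from [y]. *)
Lemma folding_contracts v s y : folding v s -> {in s, forall a, 0 <= B y a} ->
  B (travel v s - y) (travel v s - y) <= B (v - y) (v - y).
Proof.
elim: s v => //= a s IH v /and3P[aA va fs] ys.
have /(IH _ fs) : {in s, forall b, 0 <= B y b}.
  by move=> b bs; apply: ys; rewrite inE bs orbT.
move/le_trans; apply; have ya : 0 <= B y a by apply: ys; rewrite mem_head.
have -> : mirror a v - y = (v - y) - B v a *: a by rewrite /mirror addrAC.
move: (formBl v y a); move: (v - y) => w wa.
by rewrite formBl !formBr !formZl !formZr (formC a w) (normal_sq aA) wa; nra.
Qed.

(** Once all the normals still to come have been used, the constraints are
    violated by at most twice the rise so far, so a nearby point satisfies them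
    all, and the trajectory can no longer leave a ball around it. *)
Lemma future_rise v s t : folding v (s ++ t) -> {subset t <= s} ->
  B (travel v (s ++ t)) z - B (travel v s) z <=
    4 * B z z * (B (travel v s) z - B v z).
Proof.
rewrite folding_cat travel_cat => /andP[fs ft] ts.
case: t => [|a t] in ft ts *.
  by rewrite subrr !mulr_ge0 ?form_ge0 // subr_ge0 height_le.
have : s != [::] by case: (s) (ts a) => // /(_ (mem_head _ _)).
move=> /(height_lt fs); set m := travel v s; set l := B m z - B v z => lt_l.
have l_gt0 : 0 < l by rewrite subr_gt0.
(* by [visited_ge], 2 l z lifts m into every half-space *)
pose y := m + (2 * l) *: z; set w := travel m _.
have y_ge0 : {in a :: t, forall b, 0 <= B y b}.
  move=> b bt; have bs := ts _ bt.
  rewrite formDl formZl (formC z) (normal_z (folding_normal fs bs)).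
  by move: (visited_ge fs bs); rewrite -/m -/l; lra.
(* w stays within 2 l |z| of y, hence its height exceeds that of y by at most
   2 l |z|^2; expanding |w - y - 2 l z|^2 >= 0 gives this directly *)
have := folding_contracts ft y_ge0; rewrite -/w.
have -> : m - y = - (2 * l) *: z by rewrite /y opprD addNKr scaleNr.
have := form_ge0 ((w - y) - (2 * l) *: z).
move: (formBl w y z); move: (w - y) => e ez.
rewrite formBl !formBr !formZl !formZr (formC z e).
move=> h1 h2; have h : B e z <= 2 * l * B z z.
  have : 0 <= 4 * l * (2 * l * B z z - B e z) by nra.
  by rewrite pmulr_rge0 ?subr_ge0 ?mulr_gt0.
by move: h; rewrite ez /y formDl formZl; lra.
Qed.

(** [future_rise] for the time-reversed trajectory. *)
Lemma past_rise v s t : folding v (s ++ t) -> {subset s <= t} ->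
  B (travel v s) z - B v z <=
    4 * B z z * (B (travel v (s ++ t)) z - B (travel v s) z).
Proof.
move=> fst st; have [fr tr] := folding_rev fst.
move: (fst); rewrite folding_cat => /andP[_ /folding_rev[_ ]].
rewrite -travel_cat => trt; move: fr tr; rewrite rev_cat => fr tr.
have sub : {subset rev s <= rev t} by move=> b; rewrite !mem_rev; apply: st.
by have := future_rise fr sub; rewrite tr trt !formNl; lra.
Qed.

Lemma block_rise v s t u : folding v (s ++ t ++ u) ->
  {subset s <= t} -> {subset u <= t} ->
  B (travel v (s ++ t ++ u)) z - B v z <=
    (8 * B z z + 1) * (B (travel v (s ++ t)) z - B (travel v s) z).
Proof.
move=> f st ut; have := f; rewrite catA folding_cat => /andP[/past_rise/(_ st)].
move=> past _; move: f; rewrite folding_cat => /andP[_ /future_rise/(_ ut)].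
by rewrite -!travel_cat -catA; lra.
Qed.

(** By induction a block of [q ^ N] foldings uses at least [N.+1] normals, that
    is, all of them; [block_rise] then shows that [q] consecutive blocks would
    rise by more than the whole trajectory does. *)
Lemma folding_bound (q : nat) (hq : 8 * B z z + 1 < q%:R) (N : nat)
    (v : V) (s : seq V) :
  folding v s -> (size (undup s) <= N)%N -> (size s < q ^ N)%N.
Proof.
elim: N v s => [|N IH] v s fs sN.
  by move: sN; rewrite leqn0 size_eq0 => /eqP/undup_nil ->.
rewrite ltnNge expnS; apply/negP => big.
have q_gt0 : (0 < q)%N.
  rewrite -(ltr_nat R); apply: le_lt_trans hq; rewrite addr_ge0 // mulr_ge0 //.
have k_gt0 : (0 < q ^ N)%N by rewrite expn_gt0 q_gt0.
set k := (q ^ N)%N in big k_gt0 IH *.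
pose h i := B (travel v (take (i * k) s)) z.
have rise_gt0 : 0 < B (travel v s) z - B v z.
  rewrite subr_gt0 height_lt // -size_eq0 -lt0n (leq_trans _ big) //.
  by rewrite muln_gt0 q_gt0.
(* each of the first q blocks of length k takes at least a fixed share of the rise *)
have rise i : (i < q)%N ->
    B (travel v s) z - B v z <= (8 * B z z + 1) * (h i.+1 - h i).
  move=> iq; set t := take k (drop (i * k) s).
  have ik : (i * k + k <= size s)%N.
    by rewrite addnC -mulSn (leq_trans _ big) // leq_mul2r iq orbT.
  have tE : take (i.+1 * k) s = take (i * k) s ++ t.
    by rewrite mulSn addnC takeD.
  have sE : s = take (i * k) s ++ t ++ drop (i.+1 * k) s.
    by rewrite catA -tE cat_take_drop.
  have szt : size t = k.
    by rewrite size_takel // size_drop leq_subRL ?(leq_trans _ ik) ?leq_addr.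
  have ts : {subset t <= s} by move=> b /mem_take/mem_drop.
  have ft : folding (travel v (take (i * k) s)) t.
    by move: fs; rewrite {1}sE !folding_cat => /and3P[].
  have many : (size (undup s) <= size (undup t))%N.
    rewrite (leq_trans sN) // ltnNge; apply/negP => /(IH _ _ ft).
    by rewrite szt ltnn.
  have st : {subset s <= t}.
    move=> b; rewrite -(mem_undup s) -(mem_undup t).
    rewrite (uniq_min_size (undup_uniq t) _ many).2 // => c.
    by rewrite !mem_undup; apply: ts.
  have st1 : {subset take (i * k) s <= t} by move=> b /mem_take/st.
  have st2 : {subset drop (i.+1 * k) s <= t} by move=> b /mem_drop/st.
  move: fs; rewrite {1}sE => /block_rise /(_ st1 st2).
  by rewrite -sE -tE.
have hq0 : h q - h 0%N <= B (travel v s) z - B v z.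
  rewrite /h mul0n take0 lerD2r -{2}(cat_take_drop (q * k) s) travel_cat.
  apply: height_le; move: fs.
  by rewrite -{1}(cat_take_drop (q * k) s) folding_cat => /andP[].
have : \sum_(0 <= i < q) (B (travel v s) z - B v z) <=
       \sum_(0 <= i < q) (8 * B z z + 1) * (h i.+1 - h i).
  by apply: ler_sum_nat => i /andP[_]; apply: rise.
rewrite -mulr_sumr telescope_sumr // sumr_const_nat subn0 -mulr_natl.
have S_ge0 := form_ge0 z; nra.
Qed.

End Foldings.

(** * Touching balls and kissing arrangements *)

Section Euclidean.
Variables (R : realType) (d : nat).
Implicit Types (u v w p q : 'rV[R]_d).

Lemma dotpC u w : dotp u w = dotp w u.
Proof. by apply: eq_bigr => k _; rewrite mulrC. Qed.

Lemma dotpDl u v w : dotp (u + v) w = dotp u w + dotp v w.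
Proof.
by rewrite /dotp -big_split; apply: eq_bigr => k _; rewrite !mxE mulrDl.
Qed.

Lemma dotpZl c u w : dotp (c *: u) w = c * dotp u w.
Proof.
by rewrite /dotp mulr_sumr; apply: eq_bigr => k _; rewrite !mxE mulrA.
Qed.

Lemma dotp_ge0 u : 0 <= dotp u u.
Proof. by apply: sumr_ge0 => k _; rewrite -expr2 sqr_ge0. Qed.

Lemma dotpBl u v w : dotp (u - v) w = dotp u w - dotp v w.
Proof. by rewrite dotpDl -scaleN1r dotpZl mulN1r. Qed.

Lemma dotpBr u v w : dotp w (u - v) = dotp w u - dotp w v.
Proof. by rewrite dotpC dotpBl !(dotpC w). Qed.

Lemma dotpDr u v w : dotp w (u + v) = dotp w u + dotp w v.
Proof. by rewrite dotpC dotpDl !(dotpC w). Qed.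

Lemma dotpZr c u w : dotp w (c *: u) = c * dotp w u.
Proof. by rewrite dotpC dotpZl dotpC. Qed.

Lemma enorm_le u (r : R) : 0 <= r -> (enorm u <= r) = (dotp u u <= r ^+ 2).
Proof.
move=> r0; rewrite -{1}(ger0_norm r0) -sqrtr_sqr ler_sqrt //.
exact: sqr_ge0.
Qed.

Lemma touchingE p q : touching p q = (dotp (p - q) (p - q) == 4).
Proof.
rewrite /touching /enorm; apply/eqP/eqP => [h|->].
  by rewrite -[LHS]sqr_sqrtr ?dotp_ge0 // h; ring.
have -> : 4 = 2 ^+ 2 :> R by ring.
by rewrite sqrtr_sqr ger0_norm.
Qed.

Lemma unit_ballE p v : unit_ball p v = (dotp (p - v) (p - v) <= 1) :> Prop.
Proof. by rewrite /unit_ball /closed_ball_ /= enorm_le // expr1n. Qed.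

Lemma sqnorm_triangle u w (a b : R) : 0 < a -> 0 < b ->
  dotp u u <= a ^+ 2 -> dotp w w <= b ^+ 2 ->
  dotp (u + w) (u + w) <= (a + b) ^+ 2.
Proof.
move=> a0 b0 ua wb; have ab0 : 0 < a * b by rewrite mulr_gt0.
have uw : dotp u w <= a * b.
  rewrite -(ler_pM2l ab0); have := dotp_ge0 (b *: u - a *: w).
  rewrite dotpBl !dotpBr !dotpZl !dotpZr (dotpC w u).
  have : b ^+ 2 * dotp u u <= b ^+ 2 * a ^+ 2 by rewrite ler_wpM2l ?sqr_ge0.
  have : a ^+ 2 * dotp w w <= a ^+ 2 * b ^+ 2 by rewrite ler_wpM2l ?sqr_ge0.
  by lra.
by rewrite dotpDl !dotpDr (dotpC w u); lra.
Qed.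

Lemma continuous_sqdist p : continuous (fun v => dotp (p - v) (p - v)).
Proof.
apply: continuous_big => [|k _ v]; first exact: add_continuous.
have c : (fun w : 'rV[R]_d => (p - w) 0 k) @ v --> (p - v) 0 k.
  under eq_fun do rewrite !mxE; rewrite !mxE.
  exact: (cvgB (cvg_cst _) (@coord_continuous _ _ _ 0 k v)).
exact: (cvgM c c).
Qed.

(** An interior point can be pushed a little further away from the centre
    without leaving the ball, so its distance to the centre is less than 1;
    conversely the strict inequality defines an open set. *)
Lemma interior_unit_ball p v :
  interior (unit_ball p) v <-> dotp (p - v) (p - v) < 1.
Proof.
split=> [vin|lt1]; last first.
  have : \forall w \near v, dotp (p - w) (p - w) < 1.
    by apply: (@continuous_sqdist p v [set r | r < 1]); exact: lt_nbhsl.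
  by apply: filterS => w /ltW; rewrite unit_ballE.
have vp : dotp (p - v) (p - v) <= 1.
  by have := interior_subset vin; rewrite unit_ballE.
move: vin => /nbhs_ballP[e /= e0 sub].
have : unit_ball p (v + (e / 2) *: (v - p)).
  apply: sub; split=> // i k; rewrite ord1 /ball /= !mxE opprD addNKr normrN.
  rewrite normrM gtr0_norm ?divr_gt0 // distrC.
  have : `|(p - v) 0 k| <= 1.
    by apply: le_trans (coord_le_enorm _ _) _; rewrite enorm_le // expr1n.
  rewrite !mxE; nra.
rewrite unit_ballE.
have -> : p - (v + (e / 2) *: (v - p)) = (1 + e / 2) *: (p - v).
  by rewrite scalerDl scale1r -(opprB p v) scalerN opprD opprK addrA.
by rewrite dotpZl dotpZr; nra.
Qed.

(** If the centres are closer than 2, the midpoint is interior to both balls;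
    otherwise the parallelogram law excludes a common interior point.  This
    form makes nonoverlapping visibly invariant under translations. *)
Lemma nonoverlappingE p q : nonoverlapping p q <-> 4 <= dotp (p - q) (p - q).
Proof.
split=> [|ge4].
  apply: contraPT; rewrite -ltNge => lt4 /seteqP[/(_ (2^-1 *: (p + q))) + _].
  have half (a b : 'rV[R]_d) : a - 2^-1 *: (a + b) = 2^-1 *: (a - b).
    by apply/rowP => k; rewrite !mxE; field.
  apply; split; apply/interior_unit_ball.
    by rewrite half dotpZl dotpZr; lra.
  by rewrite (addrC p) half -opprB scalerN dotpN dotpZl dotpZr; lra.
apply/seteqP; split=> // v [/interior_unit_ball pv /interior_unit_ball qv].
move: ge4 pv qv (dotp_ge0 ((p - v) + (q - v))).
have -> : p - q = (p - v) - (q - v) by rewrite opprB addrA subrK.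
move: (p - v) (q - v) => a b.
by rewrite dotpBl dotpDl !dotpDr !dotprN (dotpC b a); lra.
Qed.

Lemma touching_nonoverlapping p q : touching p q -> nonoverlapping p q.
Proof. by rewrite touchingE => /eqP pq; apply/nonoverlappingE; rewrite pq. Qed.

Lemma touching_irrefl p : touching p p = false.
Proof.
by rewrite touchingE subrr /dotp big1 ?lt_eqF // => k _; rewrite mxE mul0r.
Qed.

End Euclidean.

(** Two balls fit on opposite sides of the given one. *)
Lemma kissing_number_ge2 (R : realType) (d : nat) :
  (0 < d)%N -> (2 <= kissing_number R d)%N.
Proof.
move=> d0; have [_] := kissing_numberP R d; apply.
pose e : 'rV[R]_d := delta_mx 0 (Ordinal d0).
have ee : dotp e e = 1.
  rewrite /dotp (bigD1 (Ordinal d0)) //= big1 => [|k /negPf kN].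
    by rewrite !mxE !eqxx mulr1 addr0.
  by rewrite !mxE kN mul0r.
pose y (i : 'I_2) := (2 * (-1) ^+ i) *: e.
have y0 i : touching (y i) 0.
  rewrite touchingE subr0 dotpZl dotpZr ee.
  by case: i => -[|[|//]] /= _; apply/eqP; ring.
exists y; split=> [i j ij|i]; last by split=> //; apply: touching_nonoverlapping.
apply/nonoverlappingE; rewrite -scalerBl dotpZl dotpZr ee.
by case: i j ij => -[|[|//]] ? [[|[|//]] ?] //= _; rewrite ?expr0 ?expr1; lra.
Qed.

Section Degree.
Local Open Scope set_scope.
Variables (R : realType) (n d : nat) (x : 'I_n -> 'rV[R]_d).
Hypothesis hx : pinned_balls x.

(** Translating the ball [i] to the origin turns its neighbours into a kissing
    arrangement. *)
Lemma degree_le_kissing (i : 'I_n) (S : {set 'I_n}) :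
  {in S, forall j, touching (x i) (x j)} -> (#|S| <= kissing_number R d)%N.
Proof.
move=> Si; have [_] := kissing_numberP R d; apply.
pose y (k : 'I_#|S|) := x (enum_val k) - x i.
have y0 k : touching (y k) 0.
  by rewrite /touching subr0; have := Si _ (enum_valP k); rewrite touchingC.
exists y; split=> [k l kl|k]; last by split=> //; apply: touching_nonoverlapping.
have /nonoverlappingE : nonoverlapping (x (enum_val k)) (x (enum_val l)).
  by apply: hx; apply: contra kl => /eqP/enum_val_inj ->.
by move=> h; apply/nonoverlappingE; rewrite /y opprB addrA subrK.
Qed.

Variable E : rel 'I_n.
Hypothesis E_sym : symmetric E.
Hypothesis E_touch : forall i j, E i j -> touching (x i) (x j).

(** Ordering the endpoints makes each undirected edge count once, which the
    exponent of the bound requires. *)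
Definition edges : {set 'I_n * 'I_n} :=
  [set p : 'I_n * 'I_n | (p.1 < p.2)%N && E p.1 p.2].

(** The degrees add up to twice the number of edges. *)
Lemma card_edges : (2 * #|edges| <= n * minn (kissing_number R d) n)%N.
Proof.
pose swap (p : 'I_n * 'I_n) := (p.2, p.1).
have swapK : involutive swap by case.
have swE : swap @: edges = [set p : 'I_n * 'I_n | (p.2 < p.1)%N && E p.1 p.2].
  apply/setP => p; rewrite -[p]swapK (mem_imset _ _ (inv_inj swapK)) !inE /=.
  by rewrite E_sym.
have dis : #|edges :&: swap @: edges| = 0%N.
  by apply: eq_card0 => p; rewrite swE !inE; case: ltngtP; rewrite ?andbF.
have sub : edges :|: swap @: edges \subset [set p : 'I_n * 'I_n | E p.1 p.2].
  by rewrite swE; apply/fintype.subsetP => p; rewrite !inE => /orP[] /andP[].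
rewrite mul2n -addnn -{2}(card_imset edges (inv_inj swapK)).
rewrite -[leqLHS]subn0 -dis -cardsU; apply: leq_trans (subset_leq_card sub) _.
have -> : #|[set p : 'I_n * 'I_n | E p.1 p.2]| = (\sum_i #|[set j | E i j]|)%N.
  under [RHS]eq_bigr do rewrite -sum1dep_card.
  by rewrite pair_big_dep /= -sum1dep_card.
rewrite -[X in (X * _)%N]card_ord -sum_nat_const; apply: leq_sum => i _.
have le_n : (#|[set j | E i j]| <= n)%N.
  by have := max_card [set j | E i j]; rewrite card_ord.
have le_k : (#|[set j | E i j]| <= kissing_number R d)%N.
  by apply: (@degree_le_kissing i) => j; rewrite inE => /E_touch.
by rewrite leq_min le_k le_n.
Qed.

(** Each edge has length 2. *)
Lemma path_sqdist_le i p : path E i p ->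
  dotp (x i - x (last i p)) (x i - x (last i p)) <= 4 * (size p)%:R ^+ 2.
Proof.
elim: p i => /= [|j p IH] i.
  by rewrite subrr /dotp big1 ?mulr_ge0 // => k _; rewrite mxE mul0r.
case/andP => /E_touch; rewrite touchingE => /eqP ij.
case: p IH => [_ _|k p IH /IH]; first by rewrite /= ij expr1n mulr1.
set l := last _ _; set m := size _.
have m0 : 0 < m%:R :> R by rewrite ltr0n.
move=> ww; rewrite -(subrKA (x j)).
have ij2 : dotp (x i - x j) (x i - x j) <= 2 ^+ 2 by rewrite ij; lra.
have ww2 : dotp (x j - x l) (x j - x l) <= (2 * m%:R) ^+ 2.
  by apply: le_trans ww _; rewrite exprMn; lra.
have m2 : 0 < 2 * m%:R :> R by rewrite mulr_gt0.
have := sqnorm_triangle (ltr0n R 2) m2 ij2 ww2.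
by move=> /le_trans; apply; rewrite -natr1; lra.
Qed.

(** Each connected component is translated so that one of its balls is at the
    origin.  Without this, distances between components, on which the motion
    does not depend, would enter the bound. *)
Definition recentred (i : 'I_n) : 'rV[R]_d := x i - x (fingraph.root E i).

Lemma recentred_sqnorm_le i :
  dotp (recentred i) (recentred i) <= 4 * n%:R ^+ 2.
Proof.
have /connectP[p /shortenP[q Eq Uq _] rE] := connect_root E i.
rewrite /recentred rE; apply: le_trans (path_sqdist_le Eq) _.
have : (size q <= n)%N.
  have := max_card (mem (i :: q)).
  by rewrite (card_uniqP Uq) card_ord; apply: ltnW.
rewrite -(ler_nat R); have : 0 <= (size q)%:R :> R by []. nra.
Qed.

Lemma recentredB i j : E i j -> recentred i - recentred j = x i - x j.
Proof.
move=> Eij; have Es : connect_sym E by apply: sym_connect_sym.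
have -> : recentred j = x j - x (fingraph.root E i).
  by rewrite /recentred (fingraph.rootP Es (connect1 Eij)).
by rewrite /recentred opprB addrA subrK.
Qed.
End Degree.

(** * Collisions as foldings *)

Section Velocities.
Variables (R : realType) (n d : nat).
Local Notation velocities := {ffun 'I_n -> 'rV[R]_d}.
Implicit Types (u v w : velocities).

Definition vdot v w : R := \sum_i dotp (v i) (w i).

Lemma vdotC v w : vdot v w = vdot w v.
Proof. by apply: eq_bigr => i _; rewrite dotpC. Qed.

Lemma vdotDl u v w : vdot (u + v) w = vdot u w + vdot v w.
Proof.
by rewrite /vdot -big_split; apply: eq_bigr => i _; rewrite ffunE dotpDl.
Qed.

Lemma vdotZl c v w : vdot (c *: v) w = c * vdot v w.
Proof.
by rewrite /vdot mulr_sumr; apply: eq_bigr => i _; rewrite ffunE dotpZl.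
Qed.

Lemma vdot_ge0 v : 0 <= vdot v v.
Proof. by apply: sumr_ge0 => i _; apply: dotp_ge0. Qed.

Variable x : 'I_n -> 'rV[R]_d.

(** The change of velocities per unit of approach speed; this is also the normal
    of the hyperplane of equal normal velocities of [i] and [j].  The factor 1/2
    makes the vector from [j] to [i] a unit vector when the balls touch. *)
Definition impulse (i j : 'I_n) : velocities :=
  let u := 2^-1 *: (x i - x j) in
  [ffun k => if k == i then u else if k == j then - u else 0].

(** By this symmetry the two orientations of an edge give a single normal. *)
Lemma impulseC i j : impulse i j = impulse j i.
Proof.
apply/ffunP => k; rewrite !ffunE -(opprB (x j)) scalerN.
case: (eqVneq k i) => [<-|_]; case: (eqVneq k j) => [<-|_] //.
  by rewrite subrr scaler0 oppr0.
by rewrite opprK.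
Qed.

Lemma vdot_impulse v i j : i != j ->
  vdot v (impulse i j) = 2^-1 * dotp (v i - v j) (x i - x j).
Proof.
move=> ij; rewrite /vdot (bigD1 i) //= (bigD1 j) 1?eq_sym //= big1 => [|k].
  rewrite !ffunE !eqxx eq_sym (negPf ij) dotprN !dotpZr dotpBl; ring.
case/andP => /negPf ki /negPf kj; rewrite ffunE ki kj.
by rewrite /dotp big1 // => l _; rewrite mxE mulr0.
Qed.

Lemma touching_neq i j : touching (x i) (x j) -> i != j.
Proof. by apply: contraTneq => ->; rewrite touching_irrefl. Qed.

Lemma impulse_sqnorm i j : touching (x i) (x j) ->
  vdot (impulse i j) (impulse i j) = 2.
Proof.
move=> ij; rewrite vdot_impulse ?touching_neq // !ffunE !eqxx.
have := touching_neq ij; rewrite eq_sym => /negPf ->.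
move: ij; rewrite touchingE => /eqP ij.
by rewrite opprK dotpDl !dotpZl ij; field.
Qed.

Lemma collideE i j v : touching (x i) (x j) ->
  collide x i j v = if vdot v (impulse i j) < 0
                    then mirror vdot (impulse i j) v else v.
Proof.
move=> ij; have ijN := touching_neq ij.
rewrite /collide ij vdot_impulse // pmulr_rlt0 ?invr_gt0 //=.
case: ifP => // _; rewrite /mirror vdot_impulse //.
move: (ij); rewrite /touching => /eqP ->.
apply/ffunP => k; rewrite !ffunE !dotpZr dotpBl.
case: (eqVneq k i) => [->|ki]; last case: (eqVneq k j) => [->|kj].
- by apply/rowP => l; rewrite !mxE; ring.
- by apply/rowP => l; rewrite !mxE; ring.
- by rewrite scaler0 subr0.
Qed.

End Velocities.

(** An infinite set, or one with more than [K] elements, would have a finite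
    subset with more than [K] elements, which lies in some initial segment. *)
Lemma finite_set_prefix (P : pred nat) (K : nat) :
  (forall T, size [seq j <- iota 1 T | P j] <= K)%N ->
  let S := [set j | (1 <= j)%N /\ P j] in
  finite_set S /\ (#|` fset_set S| <= K)%N.
Proof.
move=> PK S; have small (F : {fset nat}) : [set` F] `<=` S -> (#|` F| <= K)%N.
  move=> FS; apply: leq_trans (PK (\max_(j <- F) j)%N).
  apply: uniq_leq_size (fset_uniq F) _ => j jF.
  have [j1 Pj] := FS j jF.
  by rewrite mem_filter Pj mem_iota j1 ltnS (leq_bigmax_seq (F := id)).
have fS : finite_set S.
  apply: contrapT => /(infinite_set_fset K.+1)[F FS].
  by rewrite ltnNge small.
by split=> //; apply: small; rewrite fset_setK.
Qed.

Section Count.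
Variables (R : realType) (n d : nat) (x : 'I_n -> 'rV[R]_d) (E : rel 'I_n).
Hypothesis E_sym : symmetric E.
Hypothesis E_touch : forall i j, E i j -> touching (x i) (x j).
Variable gamma : nat -> 'I_n * 'I_n.
Hypothesis gammaE : forall j, (1 <= j)%N -> E (gamma j).1 (gamma j).2.
Variable v0 : {ffun 'I_n -> 'rV[R]_d}.

Let impulses := [seq impulse x p.1 p.2 | p <- enum (edges E)].

Let centre : {ffun 'I_n -> 'rV[R]_d} := [ffun i => 2^-1 *: recentred x E i].

Let impulsesP a : a \in impulses -> exists i j, a = impulse x i j /\ E i j.
Proof.
case/mapP => -[i j]; rewrite mem_enum inE => /andP[_ Eij] ->.
by exists i, j.
Qed.

Let impulse_mem i j : E i j -> impulse x i j \in impulses.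
Proof.
move=> Eij; have := touching_neq (E_touch Eij); rewrite neq_ltn => /orP[] lt.
  by apply/mapP; exists (i, j) => //; rewrite mem_enum inE lt.
apply/mapP; exists (j, i); last exact: impulseC.
by rewrite mem_enum inE lt E_sym.
Qed.

Let impulse_sq : {in impulses, forall a, vdot a a = 2}.
Proof. by move=> _ /impulsesP[i [j [-> /E_touch/impulse_sqnorm]]]. Qed.

Let impulse_centre : {in impulses, forall a, vdot a centre = 1}.
Proof.
move=> _ /impulsesP[i [j [-> Eij]]].
rewrite vdotC vdot_impulse ?(touching_neq (E_touch Eij)) // !ffunE.
rewrite -scalerBr recentredB // dotpZl.
by have := E_touch Eij; rewrite touchingE => /eqP ->; field.
Qed.

Let centre_sq : 8 * vdot centre centre + 1 < (8 * n ^ 3 + 2)%N%:R.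
Proof.
have : vdot centre centre <= \sum_(i < n) n%:R ^+ 2.
  apply: ler_sum => i _; rewrite !ffunE dotpZl dotpZr.
  by have := recentred_sqnorm_le E_touch i; lra.
rewrite sumr_const card_ord -[_ *+ n]mulr_natr -exprSr natrD natrM natrX; lra.
Qed.

Let hit j := evolve x gamma v0 j != evolve x gamma v0 j.-1.

Let trace T := [seq impulse x (gamma j).1 (gamma j).2 | j <- iota 1 T & hit j].

(** Only the collisions remain in [trace]: the other steps leave the velocities
    unchanged. *)
Let evolve_folding T :
  folding (@vdot R n d) (mem impulses) v0 (trace T) /\
  travel (@vdot R n d) v0 (trace T) = evolve x gamma v0 T.
Proof.
elim: T => [//|T [fT tT]].
have E1 : E (gamma T.+1).1 (gamma T.+1).2 by apply: gammaE.
set a := impulse x (gamma T.+1).1 (gamma T.+1).2.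
have traceS : trace T.+1 = trace T ++ (if hit T.+1 then [:: a] else [::]).
  rewrite /trace -[in LHS](addn1 T) iotaD filter_cat map_cat add1n /=.
  by case: ifP.
rewrite traceS folding_cat travel_cat fT tT /hit /= collideE ?E_touch //.
rewrite -/a; case: ltP => [lt0|_]; last by rewrite eqxx.
have aN := impulse_mem E1; rewrite ifT /= ?lt0 ?aN //.
apply/eqP => /(congr1 (fun w => vdot w a)).
rewrite (mirror_normal (@vdotDl _ _ _) (@vdotZl _ _ _) impulse_sq) //.
by lra.
Qed.

Lemma collisions_lt T :
  (size [seq j <- iota 1 T | hit j] < (8 * n ^ 3 + 2) ^ #|edges E|)%N.
Proof.
have [fT _] := evolve_folding T.
rewrite -(size_map (fun j => impulse x (gamma j).1 (gamma j).2)) -/(trace T).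
apply: (folding_bound (@vdotC R n d) (@vdotDl R n d) (@vdotZl R n d)
  (@vdot_ge0 R n d) impulse_sq impulse_centre centre_sq fT).
rewrite cardE -(size_map (fun p => impulse x p.1 p.2)).
apply: uniq_leq_size (undup_uniq _) _ => a; rewrite mem_undup.
exact: (folding_normal fT).
Qed.
End Count.

(** * Comparison with the announced bound *)

(** Because 8 n^3 + 2 <= 2^4 n^3, the left side is at most 2^(4 l) n^(3 l); the
    exponents 4 l <= 16 l - 27 and 3 l <= (15 l - 27) / 2 only need l >= 3. *)
Lemma exponent_bound (R : realType) (n N : nat) (l : R) :
  (3 <= n)%N -> 3 <= l -> N%:R <= l ->
  ((8 * n ^ 3 + 2) ^ N)%N%:R <=
    2 `^ (- 27) * 2 `^ (16 * l) * n%:R `^ (- (27 / 2)) * n%:R `^ (15 * l / 2).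
Proof.
move=> n3 l3 Nl; have n1 : 1 <= n%:R :> R by rewrite ler1n; lia.
have n0 : 0 <= n%:R :> R by [].
have -> : 2 `^ (- 27) * 2 `^ (16 * l) * n%:R `^ (- (27 / 2)) *
          n%:R `^ (15 * l / 2) =
          2 `^ (16 * l - 27) * n%:R `^ (15 * l / 2 - 27 / 2) :> R.
  rewrite -mulrA -!powRD; last 2 first.
  - by rewrite (gt_eqF (lt_le_trans ltr01 n1)) implybT.
  - by rewrite pnatr_eq0 implybT.
  by congr (_ `^ _ * _ `^ _); ring.
have base : (8 * n ^ 3 + 2)%N%:R <= 2 `^ 4 * n%:R `^ 3 :> R.
  rewrite !powR_mulrn // -!natrX -natrM ler_nat; nia.
have base1 : 1 <= 2 `^ 4 * n%:R `^ 3 :> R.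
  by apply: le_trans base; rewrite ler1n addn2.
rewrite natrX -powR_mulrn //.
apply: (@le_trans _ _ ((2 `^ 4 * n%:R `^ 3) `^ N%:R)).
  by rewrite ge0_ler_powR // nnegrE // mulr_ge0 ?powR_ge0.
apply: (@le_trans _ _ ((2 `^ 4 * n%:R `^ 3) `^ l)); first exact: ler_powR.
rewrite powRM ?powR_ge0 // -!powRrM.
by apply: ler_pM; rewrite ?powR_ge0 // ler_powR //; lra.
Qed.

Theorem theorem2p2 (R : realType) (d n : nat) (hd : (1 <= d)%N) (hn : (3 <= n)%N)
    (x : 'I_n -> 'rV[R]_d) (hx : pinned_balls x)
    (V1 : {set 'I_n}) (E1 : rel 'I_n) (hG : associated_graph x V1 E1)
    (gamma : nat -> 'I_n * 'I_n)
    (hgamma : forall j : nat, (1 <= j)%N -> E1 (gamma j).1 (gamma j).2)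
    (v0 : {ffun 'I_n -> 'rV[R]_d}) :
  let l : R := 2^-1 * n%:R * (minn (kissing_number R d) n)%:R in
  finite_set (collision_times x gamma v0) /\
  (#|` fset_set (collision_times x gamma v0)|)%:R <=
    2 `^ (- 27) * 2 `^ (16 * l) * n%:R `^ (- (27 / 2)) * n%:R `^ (15 * l / 2).
Proof.
move=> l; have [E_sym E_in] := hG.
have E_touch i j : E1 i j -> touching (x i) (x j) by case/E_in.
have [fin card] := finite_set_prefix (fun T =>
  ltnW (collisions_lt E_sym E_touch hgamma v0 T)).
split=> //; apply: (@le_trans _ _ ((8 * n ^ 3 + 2) ^ #|edges E1|)%N%:R).
  by rewrite ler_nat.
apply: exponent_bound => //.
  have -> : 3 = 2^-1 * 3%:R * 2%:R :> R by field.
  rewrite /l -!mulrA ler_wpM2l // -!natrM ler_nat leq_mul // leq_min.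
  by rewrite kissing_number_ge2 // ltnW.
have := card_edges hx E_sym E_touch.
by rewrite -(ler_nat R) !natrM /l; lra.
Qed.
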